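(* Let $F\subset\mathbb{R}^d$. Then $$\overline{\dim}_{GB} F=0\quad\text{if and only if}\quad \dim_{qA} F=0.$$
   Context: For a nonempty bounded set $E\subset\mathbb{R}^d$ and $\delta>0$, $N_\delta(E)$ denotes the smallest number of closed balls of radius $\delta$ needed to cover $E$. $B(x,R)=\{y\in\mathbb{R}^d:\|y-x\|\le R\}$ is the closed Euclidean ball. For $\theta\in(0,1)$ and $F\subset\mathbb{R}^d$ (bounded or not), the Assouad spectrum is $\dim_A^\theta F:=\inf\{s\ge 0:$ there exists a constant $C>0$ such that for all $0<r=R^{1/\theta}<R<1$ and all $x\in F$, $N_r(B(x,R)\cap F)\le C(R/r)^s\}$, and the upper spectrum is $\overline{\dim}_A^\theta F:=\inf\{s\ge 0:$ there exists a constant $C>0$ such that for all $0<r\le R^{1/\theta}<R<1$ and all $x\in F$, $N_r(B(x,R)\cap F)\le C(R/r)^s\}$. Both are $0$ for $F=\emptyset$. The quasi-Assouad dimension is $\dim_{qA}F:=\lim_{\theta\to1}\overline{\dim}_A^\theta F$ (the limit exists since $\overline{\dim}_A^\theta F$ is nondecreasing in $\theta\in(0,1)$). The generalized upper box dimension of any $F\subset\mathbb{R}^d$ is $\overline{\dim}_{GB}F:=\limsup_{\theta\to 0}\dim_A^\theta F$ (with $\theta\to0$ through $(0,1)$). *)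

(* Defs.v *)
From HB Require Import structures.
From mathcomp Require Import all_boot all_order all_algebra.
From mathcomp Require Import all_classical all_reals all_analysis.

Set Implicit Arguments.
Unset Strict Implicit.
Unset Printing Implicit Defensive.

Import Order.TTheory GRing.Theory Num.Theory.
Import numFieldNormedType.Exports.

Local Open Scope classical_set_scope.
Local Open Scope ring_scope.

Section Dimensions.
Context {R : realType} {d : nat}.
Implicit Types (x y : 'rV[R]_d) (E F : set 'rV[R]_d).

(* The norm that MathComp-Analysis puts on 'rV[R]_d is the sup norm, so the
   Euclidean norm is spelled out. *)
Definition euclidean_norm x : R := Num.sqrt (\sum_i x ord0 i ^+ 2).

Definition euclidean_ball x (rho : R) : set 'rV[R]_d :=
  [set y | euclidean_norm (y - x) <= rho].

(* The centres range over the whole space.  The value is +oo if E has no finite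
   cover; otherwise the infimum, being over natural numbers, is attained. *)
Definition covering_number (delta : R) E : \bar R :=
  ereal_inf [set n%:R%:E | n in [set n : nat |
    exists c : 'I_n -> 'rV[R]_d,
      E `<=` \bigcup_(i in [set: 'I_n]) euclidean_ball (c i) delta]].

(* These two dimensions are meaningful for 0 < theta < 1 only.  They are
   extended reals because the real-valued [inf] of an empty set is 0. *)
Definition assouad_spectrum F (theta : R) : \bar R :=
  ereal_inf [set s%:E | s in [set s : R | 0 <= s /\
    exists2 C : R, 0 < C &
      forall r rho : R,
        0 < r -> r = rho `^ theta^-1 -> rho `^ theta^-1 < rho -> rho < 1 ->
        forall x, F x ->
          (covering_number r (euclidean_ball x rho `&` F)
             <= (C * (rho / r) `^ s)%:E)%E]].

Definition upper_spectrum F (theta : R) : \bar R :=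
  ereal_inf [set s%:E | s in [set s : R | 0 <= s /\
    exists2 C : R, 0 < C &
      forall r rho : R,
        0 < r -> r <= rho `^ theta^-1 -> rho `^ theta^-1 < rho -> rho < 1 ->
        forall x, F x ->
          (covering_number r (euclidean_ball x rho `&` F)
             <= (C * (rho / r) `^ s)%:E)%E]].

(* The one-sided filters at 1 and 0 only see theta in (0, 1). *)
Definition quasi_assouad_dim F : \bar R :=
  lim (upper_spectrum F theta @[theta --> 1^'-]).

Definition generalized_upper_box_dim F : \bar R :=
  limf_esup (assouad_spectrum F) 0^'+.

End Dimensions.

(* Main.v *)
Require Import Defs.
From mathcomp Require Import all_boot all_order all_algebra.
From mathcomp Require Import all_classical all_reals all_analysis.
From mathcomp Require Import ring lra.

Set Implicit Arguments.
Unset Strict Implicit.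
Unset Printing Implicit Defensive.

Import Order.TTheory GRing.Theory Num.Theory.
Import numFieldNormedType.Exports.

Local Open Scope classical_set_scope.
Local Open Scope ring_scope.

(** The upper spectrum is nondecreasing in [theta] and dominates the Assouad
    spectrum, and the quasi-Assouad dimension is its supremum; so if the latter
    vanishes, the Assouad spectrum vanishes on (0, 1) and its upper limit at 0
    is 0.

    Conversely, suppose that the upper limit at 0 is 0 and let [e > 0]. For some
    [eta <= 1/2], the part of [F] in a ball of radius [r `^ eta] centred in [F]
    is covered by [C * r `^ (- e)] balls of radius [r]. This single bound
    bootstraps to a bound [D * r `^ (- (3 * e))] for balls of radius 1
    ([covering_number_unit_ball]): one passes from scale 1 to scale
    [r `^ eta / 2] by induction, and from there to [r] by the hypothesis,
    composing the two covers with [covering_number_trans]; the induction starts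
    from the total boundedness of the unit ball ([unit_ball_covers]).
    Finally, if [r <= rho `^ theta^-1] then [rho / r >= r `^ (theta - 1)], so
    that [r `^ (- (3 * e))] is at most [(rho / r) `^ (3 * e / (1 - theta))]:
    the upper spectrum at [theta] is at most [3 * e / (1 - theta)]
    ([upper_spectrum_le]). As [e] is arbitrary, the upper spectrum vanishes on
    (0, 1), and so does its limit at 1. *)

(** * Covers by Euclidean balls *)

Section Covers.
Context {R : realType} {d : nat}.
Implicit Types (x y : 'rV[R]_d) (E F : set 'rV[R]_d).

(** [E] is covered by [n] balls of radius [delta], the centres being
    arbitrary and possibly repeated. *)
Definition covers (n : nat) (delta : R) E :=
  exists c : 'I_n -> 'rV[R]_d,
    E `<=` \bigcup_(i in [set: 'I_n]) euclidean_ball (c i) delta.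

Lemma covers_finType (T : finType) (c : T -> 'rV[R]_d) delta E :
  (forall y, E y -> exists t, euclidean_ball (c t) delta y) ->
  covers #|T| delta E.
Proof.
move=> Ec; exists (fun i => c (enum_val i)) => y /Ec[t ty].
by exists (enum_rank t) => //=; rewrite enum_rankK.
Qed.

Lemma covers_leq m n delta E : (m <= n)%N -> covers m delta E ->
  covers n delta E.
Proof.
move=> mn [c Ec].
(* the surplus centres are set to 0 *)
exists (fun i : 'I_n => if insub (val i) is Some j then c j else 0) => y /Ec.
by move=> [j _ jy]; exists (widen_ord mn j) => //=; rewrite valK.
Qed.

Lemma covering_numberP delta E (X : R) : 0 <= X ->
  (covering_number delta E <= X%:E)%E <-> covers (Num.trunc X) delta E.
Proof.
move=> X0; split=> [EX|cE].
  (* the infimum runs over integers, so it suffices to find one below the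
     integer following [X] *)
  have : (covering_number delta E < (Num.trunc X).+1%:R%:E)%E.
    by rewrite (le_lt_trans EX)// lte_fin truncnS_gt.
  move=> /ereal_inf_lt[_ [n nE <-]]; rewrite lte_fin ltr_nat ltnS => nX.
  exact: covers_leq nX nE.
apply: (@le_trans _ _ (Num.trunc X)%:R%:E); last by rewrite lee_fin truncn_le.
by apply: ereal_inf_lbound; exists (Num.trunc X).
Qed.

Lemma covers_covering_number n delta E : covers n delta E ->
  (covering_number delta E <= n%:R%:E)%E.
Proof. by move=> nE; apply: ereal_inf_lbound; exists n. Qed.

Lemma le_covering_number delta1 delta2 E1 E2 : E1 `<=` E2 ->
  delta2 <= delta1 ->
  (covering_number delta1 E1 <= covering_number delta2 E2)%E.
Proof.
move=> E12 d21; apply: ereal_inf_le_tmp => _ [n [c cE] <-]; exists n => //.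
exists c => y /E12/cE[i _ iy]; exists i => //.
by rewrite /euclidean_ball/= (le_trans iy).
Qed.

Lemma euclidean_ball_le x (r1 r2 : R) : r1 <= r2 ->
  euclidean_ball x r1 `<=` euclidean_ball x r2.
Proof. by move=> r12 y /= /le_trans; apply. Qed.

Lemma euclidean_ballE x y (r : R) : 0 <= r ->
  euclidean_ball x r y <-> \sum_i (y - x) ord0 i ^+ 2 <= r ^+ 2.
Proof.
move=> r0; rewrite /euclidean_ball/= /euclidean_norm.
by rewrite -{1}(ger0_norm r0) -sqrtr_sqr ler_sqrt ?sqr_ge0.
Qed.

(** The centre of a covering ball may be moved to any of its points at the
    cost of doubling the radius. *)
Lemma euclidean_ball_recenter c y (r : R) : 0 <= r -> euclidean_ball c r y ->
  euclidean_ball c r `<=` euclidean_ball y (2 * r).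
Proof.
move=> r0 /(euclidean_ballE _ _ r0) cy z /(euclidean_ballE _ _ r0) cz.
apply/euclidean_ballE; first by rewrite mulr_ge0.
apply: (@le_trans _ _ (\sum_i
    (2 * (z - c) ord0 i ^+ 2 + 2 * (y - c) ord0 i ^+ 2))).
  apply: ler_sum => i _; rewrite !mxE -subr_ge0.
  set a := z _ _; set b := y _ _; set e := c _ _.
  have -> : 2 * (a - e) ^+ 2 + 2 * (b - e) ^+ 2 - (a - b) ^+ 2 =
    (a + b - 2 * e) ^+ 2 by ring.
  exact: sqr_ge0.
by rewrite big_split/= -!mulr_sumr; lra.
Qed.

(** Unit balls are totally bounded, uniformly in their centre. *)
Lemma unit_ball_covers (delta : R) : 0 < delta ->
  exists M : nat, forall x, covers M delta (euclidean_ball x 1).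
Proof.
move=> delta0.
(* a cubical grid of this mesh has cells of diameter at most [delta] *)
pose h := delta / d.+1%:R.
have h0 : 0 < h by rewrite divr_gt0.
pose K := (Num.trunc (2 / h)).+1.
exists #|{: {ffun 'I_d -> 'I_K}}| => x.
apply: (@covers_finType _
  (fun k : {ffun 'I_d -> 'I_K} => \row_i (x ord0 i - 1 + h * (k i)%:R))).
move=> y /(euclidean_ballE _ _ ler01) xy.
have yi i : 0 <= y ord0 i - x ord0 i + 1 <= 2.
  have : (y ord0 i - x ord0 i) ^+ 2 <= 1.
    rewrite expr1n in xy; apply: le_trans xy.
    rewrite (bigD1 i)//= !mxE lerDl sumr_ge0// => j _; exact: sqr_ge0.
  by move=> ?; apply/andP; split; nra.
pose a i := (y ord0 i - x ord0 i + 1) / h.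
have a0 i : 0 <= a i by case/andP: (yi i) => ? _; rewrite divr_ge0// ltW.
have aK i : (Num.trunc (a i) < K)%N.
  by rewrite ltnS le_truncn// ler_wpM2r ?invr_ge0 ?(ltW h0)//; case/andP: (yi i).
exists [ffun i => Ordinal (aK i)].
apply/euclidean_ballE; first exact: ltW.
apply: (@le_trans _ _ (\sum_(i < d) h ^+ 2)).
  apply: ler_sum => i _; rewrite !mxE ffunE /=.
  have /andP[ka ak] := truncn_itv (a0 i).
  have -> : y ord0 i - (x ord0 i - 1 + h * (Num.trunc (a i))%:R) =
     h * (a i - (Num.trunc (a i))%:R).
    have ha : h * a i = y ord0 i - x ord0 i + 1.
      by rewrite mulrC divfK ?gt_eqF.
    by rewrite mulrBr ha; ring.
  rewrite exprMn ler_piMr ?sqr_ge0//.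
  move: ak; rewrite -natr1 => ak; nra.
rewrite sumr_const card_ord -mulr_natr.
have -> : delta = h * d.+1%:R by rewrite divfK.
rewrite [leRHS]exprMn ler_pM2l ?exprn_gt0// -natrX ler_nat.
by rewrite (leq_trans (leqnSn d))// leq_pmulr.
Qed.

(** Covering numbers are submultiplicative across scales; the factor 2 comes
    from recentring the balls of radius [q] at points of [E]. *)
Lemma covering_number_trans (q r : R) E (X Y : R) :
  0 <= q -> 0 <= X -> 0 <= Y ->
  (covering_number q E <= X%:E)%E ->
  (forall y, E y ->
    (covering_number r (euclidean_ball y (2 * q) `&` E) <= Y%:E)%E) ->
  (covering_number r E <= (X * Y)%:E)%E.
Proof.
move=> q0 X0 Y0 /(covering_numberP _ _ X0)[c Ec] EY.
set n := Num.trunc X in c Ec; set k := Num.trunc Y.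
have /choice[c' Ec'] : forall i : 'I_n, exists c' : 'I_k -> 'rV[R]_d,
    euclidean_ball (c i) q `&` E `<=`
    \bigcup_(j in [set: 'I_k]) euclidean_ball (c' j) r.
  move=> i; have [[y [iy Ey]]|iE] := pselect (euclidean_ball (c i) q `&` E !=set0).
    have /(covering_numberP _ _ Y0)[c' Hc'] := EY _ Ey.
    exists c' => z [iz Ez]; apply: Hc'; split=> //.
    exact: (euclidean_ball_recenter q0 iy).
  by exists (fun=> 0) => z iz; exfalso; apply: iE; exists z.
have /covers_covering_number Er : covers #|{: 'I_n * 'I_k}| r E.
  apply: (@covers_finType _ (fun p : 'I_n * 'I_k => c' p.1 p.2)) => y Ey.
  have [i _ iy] := Ec _ Ey.
  by have [j _ jy] := Ec' i y (conj iy Ey); exists (i, j).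
apply: le_trans Er _.
by rewrite card_prod !card_ord lee_fin natrM ler_pM// truncn_le.
Qed.

End Covers.

(** * Bootstrapping a bound between two scales *)

Section UnitBallBound.
Context {R : realType} {d : nat}.
Implicit Types (x y : 'rV[R]_d) (F : set 'rV[R]_d).

(** The bootstrap: a bound of exponent [e] between the scales [r `^ eta] and
    [r] yields a bound of exponent [3 * e] between the scales [1] and [r].
    With [A = 3 * e], cover the unit ball by balls of radius [r `^ eta / 2]
    and each of these by balls of radius [r]: by induction on the scale this
    takes at most [D * (r `^ eta / 2) `^ (- A) * (C * r `^ (- e))] balls, at
    most a constant times [r `^ (- (5 / 2 * e))] as [eta <= 1 / 2].  The gap between the
    exponents [5 / 2 * e] and [3 * e] absorbs the constant [2 `^ A * C] as soon
    as [r] is small, so that [D] does not grow along the induction. *)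
Lemma covering_number_unit_ball F (eta e C : R) :
  0 < eta <= 2^-1 -> 0 < e -> 0 < C ->
  (forall r x, 0 < r < 1 -> F x ->
    (covering_number r (euclidean_ball x (r `^ eta) `&` F)
      <= (C * r `^ (- e))%:E)%E) ->
  exists2 D : R, 0 < D & forall r x, 0 < r < 1 -> F x ->
    (covering_number r (euclidean_ball x 1 `&` F)
      <= (D * r `^ (- (3 * e)))%:E)%E.
Proof.
move=> /andP[eta0 eta2] e0 C0 FC; pose A := 3 * e.
have A0 : 0 < A by rewrite mulr_gt0.
pose K := 2 `^ A * C.
have K0 : 0 < K by rewrite mulr_gt0// powR_gt0.
(* [r1] is the scale below which [K <= r `^ (- (e / 2))] and
   [2 * r <= r `^ eta / 2] *)
pose r1 := Num.min (1 / 16) (K `^ (- (2 / e))).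
have r10 : 0 < r1 by rewrite lt_min powR_gt0// andbT; lra.
have [M HM] := unit_ball_covers (d := d) r10.
exists M.+1%:R => //.
(* the scale [r `^ eta / 2] is at least [2 * r] when [r < r1], hence the
   induction on the number of doublings that bring [r] above [r1] *)
have main n : forall r x, 0 < r < 1 -> r1 <= r * 2 ^+ n -> F x ->
    (covering_number r (euclidean_ball x 1 `&` F)
      <= (M.+1%:R * r `^ (- A))%:E)%E.
  elim: n => [|n IH] r x /andP[r0 r_lt1] r1r Fx.
    have Mr : (covering_number r (euclidean_ball x 1 `&` F) <= M%:R%:E)%E.
      apply: le_trans (covers_covering_number (HM x)).
      by apply: le_covering_number; [exact: subIsetl|rewrite mulr1 in r1r].
    apply: le_trans Mr _; rewrite lee_fin.
    apply: (@le_trans _ _ M.+1%:R); first by rewrite ler_nat.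
    rewrite ler_peMr// -(powRr0 r) ger_powR ?r0 ?ltW//.
    by rewrite oppr_lt0.
  have [r1_le|r_lt] := leP r1 r.
    by apply: IH => //; rewrite ?r0// (le_trans r1_le)// ler_peMr ?(ltW r0)//
      exprn_ege1// ler1n.
  pose q := r `^ eta / 2.
  have rr : 0 < r <= 1 by rewrite r0 ltW.
  have q0 : 0 < q by rewrite divr_gt0// powR_gt0.
  have r_eta1 : r `^ eta <= 1 by rewrite -(powRr0 r) ger_powR// ltW.
  have q1 : q < 1 by rewrite /q; lra.
  have r16 : r <= 1 / 16.
    by rewrite (le_trans (ltW r_lt))// ge_min lexx.
  have rK : r <= K `^ (- (2 / e)).
    by rewrite (le_trans (ltW r_lt))// ge_min lexx orbT.
  have q2r : 2 * r <= q.
    have h : r `^ 2^-1 <= r `^ eta by rewrite ger_powR.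
    have t0 : 0 < r `^ 2^-1 by rewrite powR_gt0.
    have tt : r `^ 2^-1 ^+ 2 = r.
      by rewrite -powR_mulrn ?powR_ge0// -powRrM mulVf// powRr1// ltW.
    rewrite /q; nra.
  have Kr : K <= r `^ (- (e / 2)).
    have -> : K = (K `^ (- (2 / e))) `^ (- (e / 2)).
      rewrite -powRrM mulrNN mulrA divfK ?gt_eqF// divff// powRr1//.
      exact: ltW.
    rewrite powRN [leRHS]powRN lef_pV2 ?posrE ?powR_gt0//.
    by rewrite ge0_ler_powR ?nnegrE ?powR_ge0 ?divr_ge0 ?(ltW e0) ?(ltW r0).
  have qE : (covering_number q (euclidean_ball x 1 `&` F)
      <= (M.+1%:R * q `^ (- A))%:E)%E.
    apply: IH => //; first by rewrite q0.
    rewrite exprS mulrA in r1r; rewrite (le_trans r1r)// ler_wpM2r//.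
    by rewrite mulrC.
  apply: (@le_trans _ _ (M.+1%:R * q `^ (- A) * (C * r `^ (- e)))%:E).
    apply: (covering_number_trans (ltW q0) _ _ qE).
    - by rewrite mulr_ge0 ?powR_ge0.
    - by rewrite mulr_ge0 ?powR_ge0// ltW.
    move=> y [_ Fy]; apply: le_trans (FC r y _ Fy); last by rewrite r0.
    apply: le_covering_number => // z [yz [_ Fz]]; split => //.
    by move: yz; rewrite /q mulrC divfK.
  rewrite lee_fin -mulrA ler_wpM2l//.
  have -> : q `^ (- A) * (C * r `^ (- e)) = K * r `^ (- (eta * A + e)).
    rewrite /q powRM ?powR_ge0 ?invr_ge0// -powRrM.
    have -> : 2^-1 `^ (- A) = 2 `^ A :> R.
      by rewrite -powR_inv1// -powRrM mulrNN mul1r.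
    rewrite opprD powRD; last by rewrite (gt_eqF r0) implybT.
    by rewrite mulrN /K; ring.
  apply: (@le_trans _ _ (r `^ (- (e / 2)) * r `^ (- (eta * A + e)))).
    by rewrite ler_wpM2r ?powR_ge0.
  rewrite -powRD; last by rewrite (gt_eqF r0) implybT.
  rewrite ger_powR// /A; nra.
move=> r x r01 Fx; have /andP[r0 _] := r01.
pose n := (Num.trunc (r1 / r)).+1.
apply: (main n) => //; rewrite mulrC -ler_pdivrMr//.
apply: (@le_trans _ _ n%:R); first by rewrite ltW// truncnS_gt.
by rewrite -natrX ler_nat ltnW// ltn_expl.
Qed.

End UnitBallBound.

(** * Comparison of the spectra *)

Section Spectra.
Context {R : realType} {d : nat}.
Implicit Types (F : set 'rV[R]_d).

Lemma assouad_spectrum_ge0 F theta : (0 <= assouad_spectrum F theta)%E.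
Proof. by apply: le_ereal_inf_tmp => _ [s [s0 _] <-]; rewrite lee_fin. Qed.

Lemma upper_spectrum_ge0 F theta : (0 <= upper_spectrum F theta)%E.
Proof. by apply: le_ereal_inf_tmp => _ [s [s0 _] <-]; rewrite lee_fin. Qed.

Lemma assouad_le_upper_spectrum F theta :
  (assouad_spectrum F theta <= upper_spectrum F theta)%E.
Proof.
apply: ereal_inf_le_tmp => _ [s [s0 [C C0 HC]] <-]; exists s => //; split=> //.
by exists C => // r rho r0 rE; apply: HC; rewrite // rE.
Qed.

Lemma powR_lt1 (a p : R) : 0 < a < 1 -> 0 < p -> a `^ p < 1.
Proof.
move=> /andP[a0 a1] p0; have <- : 1 `^ p = 1 :> R by rewrite powR1.
by rewrite gt0_ltr_powR ?nnegrE ?ler01 ?(ltW a0).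
Qed.

Lemma powR_lt_self (a p : R) : 0 < a < 1 -> 1 < p -> a `^ p < a.
Proof.
move=> a01 p1; have /andP[a0 _] := a01.
rewrite -mulr_powRB1 ?(ltW a0) ?(lt_trans ltr01)// gtr_pMr//.
by rewrite powR_lt1// subr_gt0.
Qed.

(** Enlarging [theta] enlarges the range of admissible scales [r]. *)
Lemma upper_spectrum_homo F (theta1 theta2 : R) :
  0 < theta1 -> theta1 <= theta2 -> theta2 < 1 ->
  (upper_spectrum F theta1 <= upper_spectrum F theta2)%E.
Proof.
move=> t10 t12 t21; have t20 := lt_le_trans t10 t12.
apply: ereal_inf_le_tmp => _ [s [s0 [C C0 HC]] <-]; exists s => //; split=> //.
exists C => // r rho r0 r1 rhoV rho1 x Fx.
have rho0 : 0 < rho by rewrite (lt_trans _ rhoV)// (lt_le_trans r0).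
apply: HC => //.
  apply: le_trans r1 _; rewrite ger_powR ?rho0 ?(ltW rho1)//.
  by rewrite lef_pV2 ?posrE.
by rewrite powR_lt_self ?rho0// invf_gt1.
Qed.

(** A bound at the scale [r] for unit balls also serves balls of radius [rho]:
    if [r <= rho `^ theta^-1], then [rho / r >= r `^ (theta - 1)]. *)
Lemma upper_spectrum_le F (A D theta : R) : 0 <= A -> 0 < D -> 0 < theta < 1 ->
  (forall r x, 0 < r < 1 -> F x ->
    (covering_number r (euclidean_ball x 1 `&` F) <= (D * r `^ (- A))%:E)%E) ->
  (upper_spectrum F theta <= (A / (1 - theta))%:E)%E.
Proof.
move=> A0 D0 /andP[t0 t1] HD.
have t1' : 0 < 1 - theta by rewrite subr_gt0.
apply: ereal_inf_lbound; exists (A / (1 - theta)) => //.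
split; first by rewrite divr_ge0// ltW.
exists D => // r rho r0 rle rhoV rho1 x Fx.
have rrho : r < rho := le_lt_trans rle rhoV.
have rho0 : 0 < rho := lt_trans r0 rrho.
apply: (@le_trans _ _ (covering_number r (euclidean_ball x 1 `&` F))).
  apply: le_covering_number => // y [xy Fy]; split=> //.
  exact: euclidean_ball_le (ltW rho1) _ xy.
apply: le_trans (HD r x _ Fx) _; first by rewrite r0 (lt_trans rrho).
rewrite lee_fin ler_wpM2l ?(ltW D0)//.
have -> : r `^ (- A) = (r `^ (theta - 1)) `^ (A / (1 - theta)).
  rewrite -powRrM -(opprB 1 theta); congr powR.
  by rewrite mulNr mulrC divfK ?gt_eqF.
apply: ge0_ler_powR; rewrite ?nnegrE ?powR_ge0 ?divr_ge0 ?(ltW t1') ?(ltW r0)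
  ?(ltW rho0)//.
rewrite powRB ?(gt_eqF r0) ?implybT// powRr1 ?(ltW r0)//.
rewrite ler_wpM2r ?invr_ge0 ?(ltW r0)//.
have -> : rho = (rho `^ theta^-1) `^ theta.
  by rewrite -powRrM mulVf ?gt_eqF// powRr1// ltW.
by apply: ge0_ler_powR; rewrite ?nnegrE ?powR_ge0 ?(ltW t0) ?(ltW r0).
Qed.

Lemma upper_spectrum_eq0 F theta : generalized_upper_box_dim F = 0%E ->
  0 < theta < 1 -> upper_spectrum F theta = 0%E.
Proof.
move=> GB0 t01; have /andP[t0 t1] := t01.
have t1' : 0 < 1 - theta by rewrite subr_gt0.
apply/eqP; rewrite eq_le upper_spectrum_ge0 andbT.
apply/lee_addgt0Pr => eps eps0; rewrite add0e.
(* chosen so that [3 * e / (1 - theta) = eps] *)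
pose e := eps * (1 - theta) / 3.
have e0 : 0 < e by rewrite divr_gt0// mulr_gt0.
have [eta eta02 etae] : exists2 eta, 0 < eta <= 2^-1 &
    (assouad_spectrum F eta < e%:E)%E.
  have : (generalized_upper_box_dim F < e%:E)%E by rewrite GB0 lte_fin.
  move=> /ereal_inf_lt[_ [V V0 <-]] Ve.
  have h0 : 0 < 2^-1 :> R by rewrite invr_gt0.
  have [eta [Veta eta0 eta2]] : exists eta, [/\ V eta, 0 < eta & eta <= 2^-1].
    near (0:R)^'+ => eta; exists eta; split.
    - by near: eta.
    - by near: eta; exact: nbhs_right_gt.
    - by near: eta; exact: nbhs_right_le.
  exists eta; first by rewrite eta0.
  by apply: le_lt_trans Ve; apply: ereal_sup_ubound; exists eta.
have /andP[eta0 eta2] := eta02.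
have eta1 : eta < 1 by lra.
move: etae => /ereal_inf_lt[_ [s [s0 [C C0 HC]] <-]]; rewrite lte_fin => se.
have [D D0 HD] : exists2 D : R, 0 < D & forall r x, 0 < r < 1 -> F x ->
    (covering_number r (euclidean_ball x 1 `&` F)
      <= (D * r `^ (- (3 * e)))%:E)%E.
  apply: (covering_number_unit_ball eta02 e0 C0) => r x /andP[r0 r1] Fx.
  have rE : r = (r `^ eta) `^ eta^-1.
    by rewrite -powRrM divff ?gt_eqF// powRr1// ltW.
  have reta0 : 0 < r `^ eta by rewrite powR_gt0.
  have reta1 : r `^ eta < 1 by rewrite powR_lt1// r0.
  apply: le_trans (HC r (r `^ eta) r0 rE _ reta1 x Fx) _.
    by rewrite powR_lt_self ?reta0// invf_gt1.
  rewrite lee_fin ler_wpM2l ?(ltW C0)//.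
  apply: (@le_trans _ _ ((r^-1) `^ s)).
    apply: ge0_ler_powR; rewrite ?nnegrE ?divr_ge0 ?invr_ge0 ?powR_ge0 ?(ltW r0)//.
    by rewrite ler_piMl ?invr_ge0 ?(ltW r0)// ltW.
  rewrite -powR_inv1 ?(ltW r0)// -powRrM mulN1r ger_powR ?r0 ?(ltW r1)//.
  by rewrite lerN2 ltW.
have := upper_spectrum_le _ D0 t01 HD; rewrite mulr_ge0 ?(ltW e0)// => /(_ isT).
by rewrite /e mulrCA divff// mulr1 mulfK// gt_eqF.
Unshelve. all: by end_near. Qed.

(** The quasi-Assouad dimension is the supremum of the upper spectrum, by
    monotonicity. *)
Lemma upper_spectrum_le_quasi_assouad_dim F theta : 0 < theta < 1 ->
  (upper_spectrum F theta <= quasi_assouad_dim F)%E.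
Proof.
move=> /andP[t0 t1].
have cvgS : upper_spectrum F theta @[theta --> 1^'-] -->
    ereal_sup ((upper_spectrum F \o -%R) @` `]-1, 0[).
  apply/cvg_at_leftNP; apply: (nonincreasing_at_right_cvge (BLeft 0)).
    by rewrite bnd_simp ltrN10.
  move=> a b; rewrite !in_itv/= => /andP[a1 a0] /andP[b1 b0] ab.
  by apply: upper_spectrum_homo; rewrite ?oppr_gt0// ?lerN2// ltrNl.
rewrite /quasi_assouad_dim (cvg_lim _ cvgS)//.
apply: ereal_sup_ubound; exists (- theta); rewrite /= ?opprK// in_itv/=.
by rewrite ltrN2 t1 oppr_lt0.
Qed.

End Spectra.

Theorem theorem3p8 (R : realType) (d : nat) (F : set 'rV[R]_d) :
  generalized_upper_box_dim F = 0%E <-> quasi_assouad_dim F = 0%E.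
Proof.
split=> [GB0|qA0].
  apply: lim_near_cst => //; near=> theta; apply: upper_spectrum_eq0 => //.
  apply/andP; split; near: theta; [exact: nbhs_left_gt|exact: nbhs_left_lt].
apply/eqP; rewrite eq_le; apply/andP; split; last first.
  apply: limf_esup_ge0; last exact: assouad_spectrum_ge0.
  exact: filter_not_empty.
pose V := [set theta : R | 0 < theta < 1].
apply: (@le_trans _ _ (ereal_sup (assouad_spectrum F @` V))).
  apply: ereal_inf_lbound; exists V => //.
  near=> theta; rewrite /V/=; apply/andP; split; near: theta.
    exact: nbhs_right_gt.
  exact: nbhs_right_lt.
apply: ge_ereal_sup => _ [theta theta01 <-].
apply: le_trans (assouad_le_upper_spectrum F theta) _.
by rewrite -qA0; exact: upper_spectrum_le_quasi_assouad_dim.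
Unshelve. all: by end_near. Qed.
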